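(* Let $\vec{C}_6$ be the directed $6$-cycle and let $\vec{P}_3$ be the directed path with $3$ vertices and $2$ arcs. The Desargues graph $\mathcal D$ is a $\{\vec{C}_6\}_{\vec{P}_3}$-ultrahomogeneous digraph, and the Pappus graph $\mathcal P$ is a $\{\vec{C}_6\}^{\vec{P}_3}$-ultrahomogeneous digraph.
   Context: **The graphs.** The Pappus graph $\mathcal P$ is the cubic graph on vertex set $\mathbb Z_{18}$ obtained from the $18$-cycle $(0,1,\ldots,17)$ by adding the edges $\{1+6x,6+6x\}$, $\{2+6x,9+6x\}$, $\{4+6x,11+6x\}$ for $x\in\{0,1,2\}$ (mod $18$). The Desargues graph $\mathcal D$ is the cubic graph obtained from the $20$-cycle $(0,1,\ldots,19)$, whose vertices $4x,4x+1,4x+2,4x+3$ are renamed $x_0,x_1,x_2,x_3$ respectively ($x\in\mathbb Z_5$), by adding the edges $\{x_3,(x+2)_0\}$ and $\{x_1,(x+2)_2\}$ for $x\in\mathbb Z_5$ (mod $5$). **Conventions.** An undirected graph $G$ is regarded as a digraph in which every edge $\{u,v\}$ is the pair of opposite arcs $(u,v)$ and $(v,u)$; $A(\cdot)$ denotes the arc set. An induced copy of a directed cycle or directed path $\vec H$ in such a $G$ is a subdigraph isomorphic to $\vec H$ whose underlying undirected graph is an induced subgraph of the undirected graph $G$. **Definitions.** $G$ is an $\vec H$-UH (ultrahomogeneous) digraph if every isomorphism between two induced copies of $\vec H$ in $G$ extends to an automorphism of $G$. Let $\vec M$ be a subdigraph of $\vec H$ (here $\vec M=\vec P_3$, $\vec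 H=\vec C_6$) and let $G$ be both $\vec M$-UH and $\vec H$-UH. Then $G$ is an $\{\vec H\}_{\vec M}$-UH digraph (respectively, an $\{\vec H\}^{\vec M}$-UH digraph) if for each induced copy $\vec H_0$ of $\vec H$ in $G$ and each copy $\vec M_0$ of $\vec M$ contained in $\vec H_0$ there exists exactly one induced copy $\vec H_1\neq\vec H_0$ of $\vec H$ in $G$ such that $V(\vec H_0)\cap V(\vec H_1)=V(\vec M_0)$ and $A(\vec H_0)\cap\bar A(\vec H_1)=A(\vec M_0)$ (respectively, $A(\vec H_0)\cap A(\vec H_1)=A(\vec M_0)$), where $\bar A(\vec H_1)=\{(v,u):(u,v)\in A(\vec H_1)\}$ is the set of reversed arcs of $\vec H_1$. *)

(* Defs.v *)
From mathcomp Require Import all_boot all_order all_algebra.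

Set Implicit Arguments.
Unset Strict Implicit.
Unset Printing Implicit Defensive.

Import GRing.Theory.
Local Open Scope ring_scope.

(* Vertices are drawn from an ambient type T, so that a digraph and its
   subdigraphs have the same type; Leibniz equality is equality of the vertex
   sets and of the arc sets, [arcs_in] being proof-irrelevant. *)
Record digraph (T : finType) := Digraph {
  verts : {set T};
  arcs : {set T * T};
  arcs_in : arcs \subset setX verts verts
}.

Lemma arcs_in_setT (T : finType) (A : {set T * T}) :
  A \subset setX [set: T] [set: T].
Proof. by apply/subsetP => -[u v] _; rewrite in_setX !in_setT. Qed.

Definition digraph_of (T : finType) (A : {set T * T}) : digraph T :=
  Digraph (arcs_in_setT A).

Definition rev_arcs (T : finType) (A : {set T * T}) : {set T * T} :=
  [set p | (p.2, p.1) \in A].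

(* E lists each undirected edge {u, v} as a pair, in either order. *)
Definition graph_of (T : finType) (E : {set T * T}) : digraph T :=
  digraph_of (E :|: rev_arcs E).

Definition subdigraph (T : finType) (X Y : digraph T) : Prop :=
  verts X \subset verts Y /\ arcs X \subset arcs Y.

(* Adjacency in the underlying undirected graph. *)
Definition uadj (T : finType) (X : digraph T) (u v : T) : bool :=
  ((u, v) \in arcs X) || ((v, u) \in arcs X).

(* Only the restriction of f to [verts X] matters: an isomorphism
   V(X) -> V(Y) is represented by any function extending it to the ambient
   type. *)
Definition isomorphism (T T' : finType) (X : digraph T) (Y : digraph T')
    (f : T -> T') : Prop :=
  [/\ {in verts X &, injective f},
      f @: verts X = verts Y &
      {in verts X &, forall u v,
         ((f u, f v) \in arcs Y) = ((u, v) \in arcs X)}].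

Definition copy_of (T T' : finType) (H : digraph T') (X : digraph T) : Prop :=
  exists f : T' -> T, isomorphism H X f.

Definition induced_copy (T T' : finType) (H : digraph T') (G X : digraph T) :
    Prop :=
  [/\ subdigraph X G,
      copy_of H X &
      {in verts X &, forall u v, uadj X u v = uadj G u v}].

Definition UH (T T' : finType) (H : digraph T') (G : digraph T) : Prop :=
  forall (X Y : digraph T) (f : T -> T),
    induced_copy H G X -> induced_copy H G Y -> isomorphism X Y f ->
    exists g : T -> T, isomorphism G G g /\ {in verts X, g =1 f}.

(* The operation r on arc sets is [rev_arcs] for {H}_M and the identity for
   {H}^M. *)
Definition fastened_UH (r : forall T : finType, {set T * T} -> {set T * T})
    (T TH TM : finType) (H : digraph TH) (M : digraph TM) (G : digraph T) :
    Prop :=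
  [/\ exists M' : digraph TH, subdigraph M' H /\ copy_of M M',
      UH M G,
      UH H G &
      forall H0 M0 : digraph T,
        induced_copy H G H0 -> subdigraph M0 H0 -> copy_of M M0 ->
        exists! H1 : digraph T,
          [/\ induced_copy H G H1,
              H1 <> H0,
              verts H0 :&: verts H1 = verts M0 &
              arcs H0 :&: r T (arcs H1) = arcs M0]].

Definition UH_sub (T TH TM : finType) (H : digraph TH) (M : digraph TM)
    (G : digraph T) : Prop :=
  fastened_UH rev_arcs H M G.

Definition UH_sup (T TH TM : finType) (H : digraph TH) (M : digraph TM)
    (G : digraph T) : Prop :=
  fastened_UH (fun _ A => A) H M G.

Definition C6 : digraph 'Z_6 := digraph_of [set (i, i + 1) | i : 'Z_6].

Definition P3 : digraph 'I_3 :=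
  digraph_of [set p : 'I_3 * 'I_3 | p.2 == p.1.+1 :> nat].

Definition pappus : digraph 'Z_18 :=
  graph_of ([set (i, i + 1) | i : 'Z_18]
    :|: [set ((1 + 6 * x)%:R, (6 + 6 * x)%:R) | x : 'I_3]
    :|: [set ((2 + 6 * x)%:R, (9 + 6 * x)%:R) | x : 'I_3]
    :|: [set ((4 + 6 * x)%:R, (11 + 6 * x)%:R) | x : 'I_3]).

(* The vertex x_i, i.e. 4x + i, with x taken modulo 5. *)
Definition desargues_vertex (x : 'Z_5) (i : nat) : 'Z_20 :=
  (4 * x + i)%:R.

Definition desargues : digraph 'Z_20 :=
  graph_of ([set (i, i + 1) | i : 'Z_20]
    :|: [set (desargues_vertex x 3, desargues_vertex (x + 2) 0) | x : 'Z_5]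
    :|: [set (desargues_vertex x 1, desargues_vertex (x + 2) 2) | x : 'Z_5]).

(* Main.v *)
(** An induced copy of a digraph H in G is the image of an embedding H -> G, and
    G is H-ultrahomogeneous as soon as its automorphism group is transitive on
    these embeddings.  Both graphs are small enough to list all embeddings of
    P3 and C6 and all automorphisms and to check this transitivity.  A directed
    hexagon containing a given directed 2-path M0 has a rotation starting with
    M0, so the fastening condition says that for each rooted directed hexagon s
    exactly one rooted hexagon t starts with the first three vertices of s (in
    reverse order in the case of the Desargues graph) and avoids the other
    three; this too is checked on the list of hexagons. *)
Require Import Defs.
From mathcomp Require Import all_boot all_algebra.

Set Implicit Arguments.
Unset Strict Implicit.
Unset Printing Implicit Defensive.

Import GRing.Theory.

(** * Digraphs as images of injective maps *)

Lemma digraph_eq (T : finType) (X Y : digraph T) :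
  verts X = verts Y -> arcs X = arcs Y -> X = Y.
Proof.
case: X Y => [V A VA] [W B WB] /= eVW eAB; subst W B.
by congr Digraph; apply: bool_irrelevance.
Qed.

Lemma arcs_verts (T : finType) (X : digraph T) (u v : T) :
  (u, v) \in arcs X -> (u \in verts X) /\ (v \in verts X).
Proof. by move/(subsetP (arcs_in X)); rewrite in_setX => /andP[]. Qed.

Section Image.
Variables (T T' : finType) (A : {set T' * T'}).

Lemma image_arcs_in (f : T' -> T) :
  [set (f p.1, f p.2) | p in A] \subset
    setX (f @: [set: T']) (f @: [set: T']).
Proof.
by apply/subsetP => _ /imsetP[p _ ->]; rewrite in_setX !imset_f ?in_setT.
Qed.

Definition image_digraph (f : T' -> T) : digraph T :=
  Digraph (image_arcs_in f).

Lemma image_verts (f : T' -> T) i : f i \in verts (image_digraph f).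
Proof. by rewrite imset_f ?in_setT. Qed.

Lemma eq_image_digraph (f g : T' -> T) :
  f =1 g -> image_digraph f = image_digraph g.
Proof.
move=> efg; apply: digraph_eq; apply: eq_imset => //= p; by rewrite !efg.
Qed.

Lemma image_arcsE (f : T' -> T) (i j : T') : injective f ->
  ((f i, f j) \in arcs (image_digraph f)) = ((i, j) \in A).
Proof.
move=> f_inj; apply/imsetP/idP => [[[x y] Axy [/f_inj-> /f_inj->]] //|Aij].
by exists (i, j).
Qed.

(** The source has every element of [T'] as a vertex, so injectivity is global. Each arc of [X]
    joins two vertices, hence two values of [f], so [f] determines [X]. *)
Lemma isomorphismE (X : digraph T) (f : T' -> T) :
  isomorphism (digraph_of A) X f <-> injective f /\ X = image_digraph f.
Proof.
split=> [[f_inj fV fA]|[f_inj ->]].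
  have {}f_inj : injective f by move=> x y; apply: f_inj; rewrite in_setT.
  split=> //; apply: digraph_eq; first by rewrite -fV.
  apply/setP => -[u v].
  apply/idP/imsetP => [Xuv|[[i j] Aij [-> ->]]]; last by rewrite fA ?in_setT.
  have [] := arcs_verts Xuv; rewrite -fV => /imsetP[i _ ui] /imsetP[j _ vj].
  by exists (i, j); rewrite /= -?ui -?vj // -fA ?in_setT // -ui -vj.
split=> [x y _ _ /f_inj //|//|i j _ _]; exact: image_arcsE.
Qed.

End Image.

(** * Embeddings and induced copies *)

Section Embeddings.
Variables (T T' : finType) (A : {set T' * T'}) (E : {set T * T}).

(** Both arc sets are symmetrised: inducedness concerns only the underlying graphs. The orientation
    of a copy is restored by [image_digraph]. *)
Definition embedding (a : T' -> T) : Prop :=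
  injective a /\
  forall i j,
    ((a i, a j) \in arcs (graph_of E)) = ((i, j) \in arcs (graph_of A)).

Lemma graph_of_sym u v :
  ((u, v) \in arcs (graph_of E)) = ((v, u) \in arcs (graph_of E)).
Proof. by rewrite !inE /= orbC. Qed.

Lemma uadj_graph_of u v :
  uadj (graph_of E) u v = ((u, v) \in arcs (graph_of E)).
Proof. by rewrite /uadj -graph_of_sym orbb. Qed.

Lemma uadj_image (a : T' -> T) i j : injective a ->
  uadj (image_digraph A a) (a i) (a j) = ((i, j) \in arcs (graph_of A)).
Proof. by move=> a_inj; rewrite /uadj !image_arcsE // !inE. Qed.

Lemma isomorphism_embedding (X : digraph T) (a : T' -> T) :
  induced_copy (digraph_of A) (graph_of E) X ->
  isomorphism (digraph_of A) X a -> embedding a.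
Proof.
move=> [_ _ Xind] /isomorphismE[a_inj defX]; split=> // i j.
by rewrite -uadj_graph_of -Xind ?defX ?image_verts // uadj_image.
Qed.

(** The target contains both arcs of every edge, so the oriented image of an embedding is always a
    subdigraph. *)
Lemma induced_copyE (X : digraph T) :
  induced_copy (digraph_of A) (graph_of E) X <->
  exists2 a, embedding a & X = image_digraph A a.
Proof.
split=> [Xcopy|[a [a_inj aE] ->]].
  have [_ [a aX] _] := Xcopy; exists a; first exact: isomorphism_embedding aX.
  by case/isomorphismE: aX.
split.
- split; first exact: subsetT.
  apply/subsetP => _ /imsetP[[i j] Aij ->].
  by rewrite aE inE Aij.
- by exists a; apply/isomorphismE.
- move=> _ _ /imsetP[i _ ->] /imsetP[j _ ->].
  by rewrite uadj_image // uadj_graph_of aE.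
Qed.

End Embeddings.

Lemma embedding_comp (T1 T2 T3 : finType) (A1 : {set T1 * T1})
    (A2 : {set T2 * T2}) (A3 : {set T3 * T3}) (f : T1 -> T2) (g : T2 -> T3) :
  embedding A1 A2 f -> embedding A2 A3 g -> embedding A1 A3 (g \o f).
Proof.
move=> [f_inj fE] [g_inj gE]; split=> [|i j]; first exact: inj_comp.
by rewrite gE fE.
Qed.

Lemma embedding_inv (T : finType) (E : {set T * T}) (g : T -> T)
    (g_inj : injective g) :
  embedding E E g -> embedding E E (invF g_inj).
Proof.
move=> [_ gE]; split=> [|i j]; first exact: can_inj (f_invF g_inj).
by rewrite -gE !f_invF.
Qed.

Lemma embedding_automorphism (T : finType) (E : {set T * T}) (g : T -> T) :
  embedding E E g -> isomorphism (graph_of E) (graph_of E) g.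
Proof.
move=> [g_inj gE]; split=> [x y _ _ /g_inj //||u v _ _ //].
by apply/setP => x; rewrite !inE -(f_invF g_inj x) imset_f.
Qed.

(** Let [X] be the image of [a]. If automorphisms [g] and [h] carry [a0] to [a] and to [f \o a],
    then [h] after the inverse of [g] extends [f]. *)
Lemma UH_transitive (T T' : finType) (A : {set T' * T'}) (E : {set T * T})
    (a0 : T' -> T) :
  (forall a, embedding A E a ->
     exists2 g, embedding E E g & forall i, g (a0 i) = a i) ->
  UH (digraph_of A) (graph_of E).
Proof.
move=> trans X Y f Xcopy Ycopy [f_inj fV fA].
have [a [a_inj aE] defX] := (induced_copyE A E X).1 Xcopy.
have XV i : a i \in verts X by rewrite defX image_verts.
have fa_emb : embedding A E (f \o a).
  apply: (isomorphism_embedding Ycopy); split.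
  - by move=> i j _ _ /f_inj; rewrite !XV => /(_ isT isT) /a_inj.
  - by rewrite imset_comp -fV defX.
  - by move=> i j _ _; rewrite fA ?XV // defX image_arcsE.
have [g g_emb ga] := trans _ (conj a_inj aE).
have [h h_emb ha] := trans _ fa_emb.
have g_inj : injective g by case: g_emb.
exists (h \o invF g_inj); split.
  apply: embedding_automorphism; apply: embedding_comp h_emb.
  exact: embedding_inv.
by rewrite defX => _ /imsetP[i _ ->] /=; rewrite -{1}ga invF_f ha.
Qed.

(** * Enumeration of embeddings as sequences of naturals *)

Section Enumeration.
Variables (n : nat) (adj : rel nat) (h : rel nat).

(* An embedding is coded by the sequence of its values; [adj] and [h] are the
   adjacencies of the target, with vertices below n, and of the source.  Taking
   the vertices of [s] from the last one on makes most bad extensions fail at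
   the first test, consecutive vertices being adjacent in the sources used. *)
Definition extends (s : seq nat) (c : nat) : bool :=
  (adj c c == h (size s) (size s)) &&
  all (fun j => (adj (nth 0 s j) c == h j (size s)) && (nth 0 s j != c))
      (rev (iota 0 (size s))).

Fixpoint embeddings (k : nat) : seq (seq nat) :=
  if k is k'.+1 then
    [seq rcons s c | s <- embeddings k', c <- [seq c <- iota 0 n | extends s c]]
  else [:: [::]].

(** An appended value is compared only with itself and the earlier ones, whence the restriction to
    [i <= j]; the case [i = j] checks loops. *)
Lemma mem_embeddings (k : nat) (s : seq nat) :
  s \in embeddings k <->
  [/\ size s = k, forall i, i < k -> nth 0 s i < n &
      forall i j, i <= j < k ->
        adj (nth 0 s i) (nth 0 s j) = h i j /\
        (i < j -> nth 0 s i != nth 0 s j)].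
Proof.
elim: k s => [|k IHk] s /=.
  rewrite inE; split=> [/eqP-> //|[/size0nil-> //]].
  by split=> // i j; rewrite ltn0 andbF.
split.
  case/allpairsPdep => s' [c [/IHk[sz_s s_n s_adj]]].
  rewrite mem_filter mem_iota add0n /= => /andP[/andP[/eqP cc /allP sc] c_n].
  move=> {s}->; move: s' => s in sz_s s_n s_adj cc sc *.
  split=> [|i|i j]; first by rewrite size_rcons sz_s.
    rewrite ltnS leq_eqVlt nth_rcons sz_s => /predU1P[->|lt_ik].
      by rewrite ltnn eqxx.
    by rewrite lt_ik s_n.
  rewrite !nth_rcons sz_s ltnS [j <= k]leq_eqVlt.
  case/andP=> le_ij /predU1P[jk|lt_jk]; last first.
    by rewrite lt_jk (leq_ltn_trans le_ij lt_jk); apply: s_adj; rewrite le_ij.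
  rewrite jk ltnn eqxx in le_ij *.
  move: le_ij; rewrite leq_eqVlt => /predU1P[->|lt_ik].
    by rewrite ltnn eqxx cc sz_s.
  have /sc : i \in rev (iota 0 (size s)) by rewrite mem_rev mem_iota sz_s.
  by rewrite lt_ik sz_s => /andP[/eqP-> ->].
case/lastP: s => [|s c]; first by case.
rewrite size_rcons => -[[sz_s] s_n s_adj].
have nth_s i : i < k -> nth 0 (rcons s c) i = nth 0 s i.
  by move=> lt_ik; rewrite nth_rcons sz_s lt_ik.
have nth_c : nth 0 (rcons s c) k = c by rewrite nth_rcons sz_s ltnn eqxx.
apply/allpairsPdep; exists s, c; split=> //.
  apply/IHk; split=> // [i lt_ik|i j /andP[le_ij lt_jk]].
    by rewrite -nth_s // s_n // ltnW.
  rewrite -(nth_s i (leq_ltn_trans le_ij lt_jk)) -(nth_s j lt_jk).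
  by apply: s_adj; rewrite le_ij ltnW.
have c_n : c < n by rewrite -nth_c s_n.
rewrite mem_filter mem_iota add0n c_n !andbT /extends sz_s.
have := s_adj k k; rewrite nth_c leqnn ltnSn => -[] // -> _; rewrite eqxx /=.
apply/allP => i; rewrite mem_rev mem_iota add0n /= => lt_ik.
have := s_adj i k; rewrite nth_c nth_s // (ltnW lt_ik) ltnSn => -[] // ->.
by rewrite eqxx lt_ik => ->.
Qed.

End Enumeration.

Definition values (n k : nat) (a : 'I_k -> 'I_n) : seq nat :=
  [seq nat_of_ord (a i) | i <- enum 'I_k].

Lemma size_values n k (a : 'I_k -> 'I_n) : size (values a) = k.
Proof. by rewrite size_map size_enum_ord. Qed.

Lemma nth_values n k (a : 'I_k -> 'I_n) (i : 'I_k) : nth 0 (values a) i = a i.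
Proof. by rewrite (nth_map i) ?size_enum_ord // nth_ord_enum. Qed.

Lemma values_inj n k (a b : 'I_k -> 'I_n) : values a = values b -> a =1 b.
Proof. by move=> eab i; apply: val_inj; rewrite /= -!nth_values eab. Qed.

Section EnumerationCorrect.
Variables (n k : nat) (A : {set 'I_k * 'I_k}) (E : {set 'I_n * 'I_n}).
Variables (adj h : rel nat).
Hypothesis adjE : forall u v : 'I_n, ((u, v) \in arcs (graph_of E)) = adj u v.
Hypothesis hE : forall i j : 'I_k, ((i, j) \in arcs (graph_of A)) = h i j.

Lemma embeddings_complete (a : 'I_k -> 'I_n) :
  embedding A E a -> values a \in embeddings n adj h k.
Proof.
move=> [a_inj aE]; apply/mem_embeddings; rewrite size_values.
split=> // [i lt_ik|i j /andP[le_ij lt_jk]].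
  by rewrite (nth_values a (Ordinal lt_ik)).
have lt_ik := leq_ltn_trans le_ij lt_jk.
rewrite (nth_values a (Ordinal lt_ik)) (nth_values a (Ordinal lt_jk)).
rewrite -adjE aE hE; split=> // lt_ij; apply/eqP => /val_inj /a_inj [eij].
by rewrite eij ltnn in lt_ij.
Qed.

Lemma embeddings_sound (s : seq nat) : s \in embeddings n adj h k ->
  exists2 a : 'I_k -> 'I_n, embedding A E a & values a = s.
Proof.
case/mem_embeddings=> sz_s s_n s_adj.
pose a (i : 'I_k) := Ordinal (s_n i (ltn_ord i)); exists a.
  split=> [i j [eij]|i j].
    apply/eqP; rewrite -val_eqE /=; case: ltngtP => // [lt_ij|lt_ji].
      have [] := s_adj i j; rewrite ?(ltnW lt_ij) ?ltn_ord //.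
      by rewrite eij eqxx => _ /(_ lt_ij).
    have [] := s_adj j i; rewrite ?(ltnW lt_ji) ?ltn_ord //.
    by rewrite eij eqxx => _ /(_ lt_ji).
  (* Both graphs are symmetric, so the pairs in increasing order suffice. *)
  wlog le_ij : i j / i <= j => [wlog_ij|].
    case/orP: (leq_total i j) => /wlog_ij // e.
    by rewrite graph_of_sym e graph_of_sym.
  by rewrite adjE hE; have [] := s_adj i j; rewrite ?le_ij ?ltn_ord.
apply: (@eq_from_nth _ 0) => [|i]; rewrite size_values ?sz_s // => lt_ik.
by rewrite (nth_values a (Ordinal lt_ik)).
Qed.

End EnumerationCorrect.

(** * Transitivity of the automorphism group, by computation *)

(** The first embedding is the base point. Automorphisms are listed as embeddings of the graph into
    itself. *)
Definition transitive_embeddings (n k : nat) (adj h : rel nat) : bool :=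
  let embs := embeddings n adj h k in
  let images := [seq [seq nth 0 g x | x <- head [::] embs] |
                   g <- embeddings n adj adj n] in
  all (fun s => s \in images) embs.

Lemma UH_transitive_embeddings (n k : nat) (A : {set 'I_k * 'I_k})
    (E : {set 'I_n * 'I_n}) (adj h : rel nat) :
  (forall u v : 'I_n, ((u, v) \in arcs (graph_of E)) = adj u v) ->
  (forall i j : 'I_k, ((i, j) \in arcs (graph_of A)) = h i j) ->
  transitive_embeddings n k adj h -> UH (digraph_of A) (graph_of E).
Proof.
move=> adjE hE trans X Y f Xcopy.
have [a a_emb _] := (induced_copyE A E X).1 Xcopy.
have a_in := embeddings_complete adjE hE a_emb.
(* The given copy [X] makes the list nonempty, so [head] does not return its default. *)
have [a0 a0_emb defa0] : exists2 a0 : 'I_k -> 'I_n, embedding A E a0 &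
    values a0 = head [::] (embeddings n adj h k).
  apply: (embeddings_sound adjE hE).
  by case: (embeddings n adj h k) a_in => //= s l _; rewrite mem_head.
move: X Y f Xcopy; apply: (@UH_transitive _ _ _ _ a0) => b b_emb.
have /(allP trans)/mapP[_ /(embeddings_sound adjE adjE)[g g_emb <-]] :=
  embeddings_complete adjE hE b_emb.
rewrite -defa0 -map_comp => defb; exists g => // i; apply: val_inj => /=.
rewrite -[RHS]nth_values defb (nth_map i) ?size_enum_ord // nth_ord_enum /=.
by rewrite nth_values.
Qed.

(** * Directed hexagons through a given 2-path *)

Section Hexagons.
Local Open Scope ring_scope.

Definition C6_arcs : {set 'Z_6 * 'Z_6} := [set (i, i + 1) | i : 'Z_6].
Definition P3_arcs : {set 'I_3 * 'I_3} :=
  [set p : 'I_3 * 'I_3 | p.2 == p.1.+1 :> nat].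

Lemma C6_arcsE (i j : 'Z_6) : ((i, j) \in C6_arcs) = (j == i + 1).
Proof. by apply/imsetP/eqP => [[x _ [-> ->]] //|->]; exists i. Qed.

Lemma P3_arcsE (i j : 'I_3) : ((i, j) \in P3_arcs) = (j == i.+1 :> nat).
Proof. by rewrite inE. Qed.

(** Rotations are automorphisms of the directed 6-cycle, so a parametrisation can be shifted to
    start at [x]; its next two values are then forced by the arcs. *)
Lemma rotated_hexagon (T : finType) (E : {set T * T}) (X : digraph T)
    (x y z : T) :
  induced_copy C6 (graph_of E) X ->
  (x, y) \in arcs X -> (y, z) \in arcs X ->
  exists a : 'Z_6 -> T,
    [/\ embedding C6_arcs E a, X = image_digraph C6_arcs a &
        [/\ a 0 = x, a 1 = y & a (1 + 1) = z]].
Proof.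
move=> Xcopy; have [_ [a aX] _] := Xcopy.
have [a_inj defX] := (isomorphismE C6_arcs X a).1 aX.
have [_ aV aA] := aX.
rewrite {1 2}defX => /imsetP[_ /imsetP[i _ ->] [-> ->]].
(* The second arc starts at [a (i + 1)], so injectivity of [a] makes its index [i + 1]. *)
case/imsetP=> _ /imsetP[j _ ->] [/= /a_inj <- ->].
pose b k := a (i + k); have bX : isomorphism C6 X b.
  split=> [k l _ _ /a_inj/addrI //||k l _ _].
    rewrite -aV; apply/setP => u; apply/imsetP/imsetP => -[k _ ->].
      by exists (i + k); rewrite ?in_setT.
    by exists (k - i); rewrite ?in_setT // /b addrC subrK.
  rewrite aA ?in_setT // [RHS]C6_arcsE [LHS]C6_arcsE.
  by rewrite -addrA (inj_eq (addrI i)).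
exists b; split; first exact: isomorphism_embedding Xcopy bX.
  by case/isomorphismE: bX.
by rewrite /b addr0 addrA.
Qed.

End Hexagons.

Definition inject36 (k : 'I_3) : 'Z_6 := widen_ord (isT : 3 <= 6) k.

(** With [rv] set, the common path is traversed in opposite directions by the two hexagons. *)
Definition flip (rv : bool) (k : 'I_3) : 'I_3 := if rv then rev_ord k else k.

Lemma flipK rv : involutive (flip rv).
Proof. by case: rv => // k; apply: rev_ordK. Qed.

Lemma flip_arc rv (k l : 'I_3) :
  ((flip rv k, flip rv l) \in P3_arcs) =
    ((if rv then (l, k) else (k, l)) \in P3_arcs).
Proof.
by case: rv; rewrite !P3_arcsE //; move: k l => [[|[|[|//]]] ?] [[|[|[|//]]] ?].
Qed.

Lemma hexagon_through_path (T : finType) (E : {set T * T}) (X : digraph T)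
    (m : 'I_3 -> T) :
  induced_copy C6 (graph_of E) X ->
  {in P3_arcs, forall p, (m p.1, m p.2) \in arcs X} ->
  exists a : 'Z_6 -> T,
    [/\ embedding C6_arcs E a, X = image_digraph C6_arcs a &
        forall k, a (inject36 k) = m k].
Proof.
move=> Xcopy mX.
have m01 : (m 0%R, m 1%R) \in arcs X by apply: (mX (_, _)); rewrite P3_arcsE.
have m12 : (m 1%R, m (1 + 1)%R) \in arcs X.
  by apply: (mX (_, _)); rewrite P3_arcsE.
have [a [a_emb defX [a0 a1 a2]]] := rotated_hexagon Xcopy m01 m12.
exists a; split=> // -[[|[|[|//]]] lt_k3].
- by rewrite (_ : Ordinal lt_k3 = 0%R) -?a0; [congr a|]; apply: val_inj.
- by rewrite (_ : Ordinal lt_k3 = 1%R) -?a1; [congr a|]; apply: val_inj.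
- by rewrite (_ : Ordinal lt_k3 = (1 + 1)%R) -?a2; [congr a|]; apply: val_inj.
Qed.

(** From an index below 3 the successor does not wrap modulo 6, so the first three vertices of the
    hexagon span only the arcs of the path. *)
Lemma inject36_arc (i j : 'Z_6) : i < 3 -> j < 3 -> (i, j) \in C6_arcs ->
  exists k l, [/\ i = inject36 k, j = inject36 l & (k, l) \in P3_arcs].
Proof.
move=> lt_i3 lt_j3; rewrite C6_arcsE => ij.
exists (Ordinal lt_i3), (Ordinal lt_j3); split; try exact: val_inj.
rewrite P3_arcsE /= (eqP ij).
by case: i lt_i3 {lt_j3 ij} => [[|[|[|[|[|[|//]]]]]] ?].
Qed.

Lemma inject36_arcs k l : (k, l) \in P3_arcs ->
  (inject36 k, inject36 l) \in C6_arcs.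
Proof.
rewrite P3_arcsE C6_arcsE -val_eqE.
by move: k l => [[|[|[|//]]] ?] [[|[|[|//]]] ?].
Qed.

(** * The fastening condition on rooted hexagons *)

(** Here [3 - k.+1] is the value of [rev_ord k], and [iota 3 3] lists the indices 3, 4, 5 off the
    path. *)
Definition fastened (rv : bool) (s t : seq nat) : bool :=
  all (fun k => nth 0 t k == nth 0 s (if rv then 3 - k.+1 else k)) (iota 0 3) &&
  all (fun i => nth 0 s i \notin t) (iota 3 3).

(** As ['Z_6] is convertible to ['I_6], [values] applies with explicit length 6. Avoiding the last
    three vertices means that common vertices have index below 3 in [a]. *)
Lemma fastenedP (n : nat) rv (a b : 'Z_6 -> 'I_n) :
  fastened rv (@values n 6 a) (@values n 6 b) <->
  (forall k, b (inject36 k) = a (inject36 (flip rv k))) /\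
  (forall i j, a i = b j -> i < 3).
Proof.
have flip_val (k : 'I_3) : (if rv then 3 - k.+1 else k) = inject36 (flip rv k).
  by case: rv.
split=> [/andP[/allP ab /allP disj]|[ab disj]].
  split=> [k|i j eij].
    apply: val_inj => /=; rewrite -!(@nth_values n 6).
    have /ab : (k : nat) \in iota 0 3 by rewrite mem_iota ltn_ord.
    by rewrite flip_val => /eqP.
  rewrite ltnNge; apply/negP => le_3i.
  have /disj : (i : nat) \in iota 3 3 by rewrite mem_iota le_3i ltn_ord.
  rewrite (@nth_values n 6) eij => /mapP[]; exists j => //.
  by rewrite mem_enum.
apply/andP; split; apply/allP => i.
  rewrite mem_iota add0n /= => lt_i3.
  have := ab (Ordinal lt_i3); move/(congr1 val) => /=.
  rewrite -!(@nth_values n 6) -flip_val /= => ->.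
  exact: eqxx.
rewrite mem_iota => /andP[le_3i lt_i6].
rewrite (@nth_values n 6 a (Ordinal lt_i6)); apply/mapP => -[j _ /val_inj eij].
by have := disj _ _ eij; rewrite ltnNge le_3i.
Qed.

Definition C6_adj : rel nat := fun i j => (j == i.+1 %% 6) || (i == j.+1 %% 6).
Definition P3_adj : rel nat := fun i j => (j == i.+1) || (i == j.+1).

Lemma C6_adjE (i j : 'I_6) :
  ((i, j) \in arcs (graph_of C6_arcs)) = C6_adj i j.
Proof.
by rewrite inE [X in _ || X]inE !(C6_arcsE i, C6_arcsE j) -!val_eqE /= !addn1.
Qed.

Lemma P3_adjE (i j : 'I_3) :
  ((i, j) \in arcs (graph_of P3_arcs)) = P3_adj i j.
Proof. by rewrite !inE. Qed.

(** Each undirected hexagon is listed once per root and direction, so testing every [s] covers every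
    2-path of every directed hexagon. *)
Definition unique_fastened (rv : bool) (n : nat) (adj : rel nat) : bool :=
  let hexagons := embeddings n adj C6_adj 6 in
  all (fun s => size [seq t <- hexagons | fastened rv s t] == 1) hexagons.

Section UniqueFastened.
Variables (n : nat) (E : {set 'I_n * 'I_n}) (adj : rel nat) (rv : bool).
Variable r : {set 'I_n * 'I_n} -> {set 'I_n * 'I_n}.
Hypothesis rE : forall B u v,
  ((u, v) \in r B) = ((if rv then (v, u) else (u, v)) \in B).
Hypothesis adjE : forall u v : 'I_n, ((u, v) \in arcs (graph_of E)) = adj u v.
Hypothesis unique : unique_fastened rv n adj.

(** Rooting [H0] at [M0], and [H1] at [M0] or its reversal, turns the conditions on [H1] into
    [fastened] for the codes. *)
Lemma exists_unique_fastened (H0 M0 : digraph 'I_n) :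
  induced_copy C6 (graph_of E) H0 -> subdigraph M0 H0 -> copy_of P3 M0 ->
  exists! H1 : digraph 'I_n,
    [/\ induced_copy C6 (graph_of E) H1, H1 <> H0,
        verts H0 :&: verts H1 = verts M0 &
        arcs H0 :&: r (arcs H1) = arcs M0].
Proof.
move=> H0copy [_ M0H0] [m /(isomorphismE P3_arcs)[m_inj defM0]].
have mM0 : {in P3_arcs, forall p, (m p.1, m p.2) \in arcs M0}.
  by move=> [k l] kl; rewrite defM0 image_arcsE.
have [a [a_emb defH0 am]] := hexagon_through_path H0copy
  (fun p pP => subsetP M0H0 _ (mM0 p pP)).
have a_inj : injective a by case: a_emb.
have := allP unique _ (embeddings_complete adjE C6_adjE a_emb).
case def_t: [seq t <- _ | _] => [|t []] // _.
have : t \in [:: t] by rewrite mem_head.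
rewrite -def_t mem_filter => /andP[at_ /(embeddings_sound adjE C6_adjE)].
case=> b b_emb def_b; have b_inj : injective b by case: b_emb.
move: at_; rewrite -def_b => /fastenedP[ab disj].
have bm k : b (inject36 k) = m (flip rv k) by rewrite ab am.
exists (image_digraph C6_arcs b); split.
  have VI : verts H0 :&: verts (image_digraph C6_arcs b) = verts M0.
    apply/setP => u; rewrite inE defH0 defM0.
    apply/andP/imsetP => [[/imsetP[i _ ->] /imsetP[j _ /disj lt_i3]]|[k _ ->]].
      exists (Ordinal lt_i3); rewrite ?in_setT // -am; congr a.
      exact: val_inj.
    by rewrite -{1}am -{2}[k](flipK rv) -bm !image_verts.
  split=> // [|H1H0|].
  - by apply/(induced_copyE C6_arcs); exists b.
  (* The vertex [a 3] lies off the path, so the hexagon of [b] misses it and differs from [H0]. *)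
  - have := image_verts C6_arcs a (inord 3); rewrite -defH0 -H1H0.
    by case/imsetP=> j _ /disj; rewrite inordK.
  apply/setP => -[u v]; rewrite inE rE; apply/andP/idP => [[]|Muv].
    (* Both ends of a common arc are common vertices, hence have index below 3; such an arc of [H0]
       belongs to the path. *)
    rewrite {1}defH0 => /imsetP[[i j] ij [-> ->]] /= bij.
    have [Vi Vj] : a i \in verts (image_digraph C6_arcs b) /\
                   a j \in verts (image_digraph C6_arcs b).
      by case: rv bij => bij;
        have [] := @arcs_verts _ (image_digraph C6_arcs b) _ _ bij.
    case/imsetP: Vi Vj => i' _ /disj lt_i3 /imsetP[j' _ /disj lt_j3].
    have [k [l [-> -> kl]]] := inject36_arc lt_i3 lt_j3 ij.
    by rewrite !am; apply: (mM0 (k, l)).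
  split; first exact: (subsetP M0H0).
  move: Muv; rewrite defM0 => /imsetP[[k l] kl [-> ->]] /=.
  have := flip_arc rv (flip rv k) (flip rv l); rewrite !flipK kl => /esym kl'.
  rewrite -[k](flipK rv) -[l](flipK rv) -!bm.
  by case: rv kl' => kl'; rewrite image_arcsE // inject36_arcs.
(* Uniqueness: [H1] contains the path, reversed if [rv] holds. Rooted there as [c], its code passes
   the filter whose only element is [t]. *)
move=> H1 [H1copy _ VI AI].
have mH1 : {in P3_arcs, forall p,
    (m (flip rv p.1), m (flip rv p.2)) \in arcs H1}.
  have arcH1 k l : (k, l) \in P3_arcs ->
      (if rv then (m l, m k) else (m k, m l)) \in arcs H1.
    by move=> kl; have := mM0 _ kl; rewrite -AI inE rE => /andP[].
  move=> [k l] kl /=; have := flip_arc rv l k.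
  have := arcH1 (flip rv l) (flip rv k).
  by case: rv arcH1 => [_ + e|/(_ _ _ kl) //]; rewrite e; apply.
have [c [c_emb defH1 cm]] := hexagon_through_path (m := m \o flip rv) H1copy mH1.
rewrite defH1; apply: eq_image_digraph; apply: values_inj.
rewrite def_b.
suff : @values n 6 c \in [:: t] by rewrite inE => /eqP ->.
rewrite -def_t mem_filter (embeddings_complete adjE C6_adjE c_emb) andbT.
apply/fastenedP; split=> [k|i j aicj]; first by rewrite cm /= am.
have : a i \in verts M0.
  by rewrite -VI inE {1}defH0 defH1 image_verts aicj image_verts.
by rewrite defM0 => /imsetP[k _]; rewrite -am => /a_inj ->; apply: ltn_ord k.
Qed.

End UniqueFastened.

Lemma fastened_hexagons (r : forall T : finType, {set T * T} -> {set T * T})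
    (rv : bool) (n : nat) (E : {set 'I_n * 'I_n}) (adj : rel nat) :
  (forall B u v,
     ((u, v) \in r 'I_n B) = ((if rv then (v, u) else (u, v)) \in B)) ->
  (forall u v : 'I_n, ((u, v) \in arcs (graph_of E)) = adj u v) ->
  transitive_embeddings n 3 adj P3_adj ->
  transitive_embeddings n 6 adj C6_adj ->
  unique_fastened rv n adj ->
  fastened_UH r C6 P3 (graph_of E).
Proof.
move=> rE adjE P3_trans C6_trans unique; split.
- exists (image_digraph P3_arcs inject36); split.
    split; first exact: subsetT.
    by apply/subsetP => _ /imsetP[[k l] kl ->]; apply: inject36_arcs.
  exists inject36; apply/(isomorphismE P3_arcs); split=> // k l [kl].
  exact: val_inj.
- exact: UH_transitive_embeddings adjE P3_adjE P3_trans.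
- exact: UH_transitive_embeddings adjE C6_adjE C6_trans.
- exact: exists_unique_fastened rE adjE unique.
Qed.

(** * Computable adjacency of the two graphs *)

(* The sets of edges are transferred to lists of pairs of naturals because finite
   sets do not evaluate. *)
Definition lists_edges (n : nat) (E : {set 'I_n * 'I_n})
    (e : seq (nat * nat)) : Prop :=
  forall u v, ((u, v) \in E) = ((val u, val v) \in e).

Lemma lists_edgesU n (E1 E2 : {set 'I_n * 'I_n}) e1 e2 :
  lists_edges E1 e1 -> lists_edges E2 e2 -> lists_edges (E1 :|: E2) (e1 ++ e2).
Proof. by move=> E1e E2e u v; rewrite inE mem_cat E1e E2e. Qed.

Lemma lists_edges_imset (m n : nat) (F G : 'I_m -> 'I_n) (f g : nat -> nat) :
  (forall x, F x = f x :> nat) -> (forall x, G x = g x :> nat) ->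
  lists_edges [set (F x, G x) | x : 'I_m] [seq (f x, g x) | x <- iota 0 m].
Proof.
move=> Ff Gg u v; apply/imsetP/mapP => [[x _ [-> ->]]|[x]].
  by exists (val x); rewrite ?mem_iota ?add0n ?ltn_ord //= Ff Gg.
rewrite mem_iota add0n /= => lt_xm [ux vx].
exists (Ordinal lt_xm) => //.
by congr (_, _); apply: val_inj; [rewrite /= Ff|rewrite /= Gg].
Qed.

Definition neighbours (n : nat) (e : seq (nat * nat)) : seq (seq nat) :=
  [seq [seq v <- iota 0 n | ((u, v) \in e) || ((v, u) \in e)] | u <- iota 0 n].

Definition adjacent (nbrs : seq (seq nat)) : rel nat :=
  fun u v => v \in nth [::] nbrs u.

Lemma adjacent_neighbours n e (E : {set 'I_n * 'I_n}) :
  lists_edges E e ->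
  forall u v : 'I_n,
    ((u, v) \in arcs (graph_of E)) = adjacent (neighbours n e) u v.
Proof.
move=> Ee u v; rewrite /adjacent (nth_map 0) ?size_iota // nth_iota // add0n.
by rewrite mem_filter mem_iota add0n ltn_ord !andbT !inE !Ee.
Qed.

(** The nesting of [++] matches the unions in [pappus], so that [lists_edgesU] applies piece by
    piece; [%% 18] is the value of a natural cast into ['Z_18]. *)
Definition pappus_edges : seq (nat * nat) :=
  (([seq (i, (i + 1) %% 18) | i <- iota 0 18] ++
    [seq ((1 + 6 * x) %% 18, (6 + 6 * x) %% 18) | x <- iota 0 3]) ++
   [seq ((2 + 6 * x) %% 18, (9 + 6 * x) %% 18) | x <- iota 0 3]) ++
   [seq ((4 + 6 * x) %% 18, (11 + 6 * x) %% 18) | x <- iota 0 3].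

Definition desargues_edges : seq (nat * nat) :=
  ([seq (i, (i + 1) %% 20) | i <- iota 0 20] ++
   [seq ((4 * x + 3) %% 20, (4 * ((x + 2) %% 5) + 0) %% 20) | x <- iota 0 5]) ++
   [seq ((4 * x + 1) %% 20, (4 * ((x + 2) %% 5) + 2) %% 20) | x <- iota 0 5].

(** Stored in normal form so that adjacency tests do not recompute the lists. *)
Definition pappus_neighbours : seq (seq nat) :=
  Eval vm_compute in neighbours 18 pappus_edges.
Definition desargues_neighbours : seq (seq nat) :=
  Eval vm_compute in neighbours 20 desargues_edges.

Theorem theorem2 : UH_sub C6 P3 desargues /\ UH_sup C6 P3 pappus.
Proof.
split.
- apply: (@fastened_hexagons _ true 20 _ (adjacent desargues_neighbours)).
  + by move=> B u v; rewrite inE.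
  + apply: (@adjacent_neighbours 20 desargues_edges).
    by do ?apply: lists_edgesU; apply: (@lists_edges_imset _ 20) => // x;
      exact: (@val_Zp_nat 20).
  (* The three computations: transitivity on 2-paths, transitivity on hexagons, and uniqueness of
     the fastened hexagon. *)
  + by vm_compute.
  + by vm_compute.
  + by vm_compute.
- apply: (@fastened_hexagons _ false 18 _ (adjacent pappus_neighbours)).
  + by [].
  + apply: (@adjacent_neighbours 18 pappus_edges).
    by do ?apply: lists_edgesU; apply: (@lists_edges_imset _ 18) => // x;
      exact: (@val_Zp_nat 18).
  + by vm_compute.
  + by vm_compute.
  + by vm_compute.
Qed.
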